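(* Let $p$ be a prime number and let $k \geq 2$ be an integer with $k - 1 = \langle e_0, \ldots, e_t \rangle_p$. Then there exist a $p$-tree $\mathcal{T}_p(k)$ of root $k - 1$ and a nonnegative integer $W_p(k)$ such that for all integers $n = \langle e_0, \ldots, e_t, d_{t+1}, \ldots, d_s \rangle_p$ and $r \in [t+1, s]$ we have: (i) if $\langle e_0, \ldots, e_t, d_{t+1}, \ldots, d_r \rangle_p \in \mathcal{T}_p(k)$, then $\nu_p(H(n,k)) \geq W_p(k) + r - ks + 1$; (ii) if $\langle e_0, \ldots, e_t, d_{t+1}, \ldots, d_r \rangle_p \in \mathcal{T}_p(k)^\star$, then $\nu_p(H(n,k)) = W_p(k) + r - ks$. Moreover, the girth of $\mathcal{T}_p(k)$ is less than $p^{0.835}$. In particular, the girth of $\mathcal{T}_2(k)$ is equal to $1$.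
   Context: For integers $n \geq k \geq 1$, $H(n,k) := \sum_{1 \leq i_1 < \cdots < i_k \leq n} \frac{1}{i_1 \cdots i_k}$. $\nu_p$ denotes the $p$-adic valuation on the rationals. For a prime $p$, the notation $\langle a_0, \ldots, a_v \rangle_p := \sum_{i=0}^v a_i p^{v-i}$ always means a base-$p$ representation, i.e. it implicitly requires $a_0, \ldots, a_v \in \{0, \ldots, p-1\}$ and $a_0 \neq 0$. A $p$-tree of root $\langle a_0, \ldots, a_v \rangle_p$ is a set $\mathcal{T}$ of positive integers such that: (T1) $\langle a_0, \ldots, a_v \rangle_p \in \mathcal{T}$; (T2) if $\langle b_0, \ldots, b_u \rangle_p \in \mathcal{T}$ then $u \geq v$ and $b_i = a_i$ for $i = 0, \ldots, v$; (T3) if $\langle b_0, \ldots, b_u \rangle_p \in \mathcal{T}$ and $u > v$ then $\langle b_0, \ldots, b_{u-1} \rangle_p \in \mathcal{T}$. A leaf of $\mathcal{T}$ is an integer $\langle b_0, \ldots, b_u \rangle_p$ with $u > v$ such that $\langle b_0, \ldots, b_{u-1} \rangle_p \in \mathcal{T}$ but $\langle b_0, \ldots, b_u \rangle_p \notin \mathcal{T}$; the set of leaves is $\mathcal{T}^\star$. The girth of $\mathcal{T}$ is the greatest integer $g$ such that for every $\langle b_0, \ldots, b_u \rangle_p \in \mathcal{T}$ we have $\langle b_0, \ldots, b_u, c \rangle_p \in \mathcal{T}$ for at least $g$ values of $c \in \{0, \ldots, p-1\}$. *)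

(* Defs.v *)
From HB Require Import structures.
From mathcomp Require Import all_boot all_order all_algebra.
From Stdlib Require Reals.
Set Implicit Arguments. Unset Strict Implicit. Unset Printing Implicit Defensive.
Import Order.TTheory GRing.Theory Num.Theory.

(* H(n,k) = sum over k-subsets {i_1<...<i_k} of {1..n} of 1/(i_1...i_k).
   A subset of 'I_n = {0..n-1} is shifted by one: i in S stands for i+1. *)
Definition H (n k : nat) : rat :=
  (\sum_(S : {set 'I_n} | #|S| == k) \prod_(i in S) (i.+1%:R)^-1)%R.

(* p-adic valuation of a rational: nu_p(a/b) = v_p(a) - v_p(b).
   (Convention nu_p(0) = 0; only used on H(n,k) > 0.) *)
Definition nu (p : nat) (q : rat) : int :=
  (logn p (absz (numq q)))%:Z - (logn p (absz (denq q)))%:Z.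

Definition fromdigits (p : nat) (s : seq nat) : nat :=
  foldl (fun acc a => acc * p + a) 0 s.

(* Base-p representation of m (most significant digit first);
   [::] for m = 0.  Fuel m suffices for p >= 2. *)
Fixpoint digits_rec (p fuel m : nat) : seq nat :=
  match fuel with
  | 0 => [::]
  | f.+1 => if m == 0 then [::] else rcons (digits_rec p f (m %/ p)) (m %% p)
  end.
Definition digits (p m : nat) : seq nat := digits_rec p m m.

Definition parent (p b : nat) : nat :=
  fromdigits p (take (size (digits p b)).-1 (digits p b)).

Definition ptree (p : nat) (T : pred nat) (root : nat) : Prop :=
  [/\ T root,
      (forall b, T b -> 0 < b /\ prefix (digits p root) (digits p b)) &
      (forall b, T b -> size (digits p root) < size (digits p b) ->
                 T (parent p b))].

Definition leaf (p : nat) (T : pred nat) (root : nat) (m : nat) : Prop :=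
  [/\ size (digits p root) < size (digits p m), T (parent p m) & ~~ T m].

Definition nchildren (p : nat) (T : pred nat) (b : nat) : nat :=
  count (fun c => T (fromdigits p (digits p b ++ [:: c]))) (iota 0 p).

Definition girth (p : nat) (T : pred nat) (g : nat) : Prop :=
  (forall b, T b -> g <= nchildren p T b) /\
  (forall g', (forall b, T b -> g' <= nchildren p T b) -> g' <= g).

Definition lt_pow0835 (g p : nat) : Prop :=
  Rdefinitions.Rlt (Raxioms.INR g)
    (Rpower.Rpower (Raxioms.INR p)
       (Rdefinitions.Rdiv (Raxioms.INR 835) (Raxioms.INR 1000))).

(* Main.v *)
Require Import Defs.
From HB Require Import structures.
From mathcomp Require Import all_boot all_order all_algebra.
From mathcomp Require Import zify ring.
From Stdlib Require Import Classical.

(* Put K = k - 1, let n have h digits beyond those of K, and scale H(n,k) by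
   p^(hk) K!.  This is K! times the coefficient of X^k in
   prod_(i <= n) (1 + p^h X / i).  The factors with p^h | i contribute
   prod_(i <= K) (1 + X / i), with denominator K!, and a factor with v_p(i) < j is
   1 modulo p^(h-j+1).  Hence deleting the last j digits of n changes the scaled value
   only modulo p^(h-j+1), and the tree consists of the m with u extra digits at which
   the scaled value vanishes modulo p^(u+1).

   Among the children of a node, the quotient of the scaled value by p^u varies with
   the last digit c as a + sum_(i <= c) 1/i in F_p.  If this vanishes at two digits at
   distance d, the larger one is a root of the derivative of X(X-1)...(X-d+1), so at
   most d - 1 such pairs exist; counting gaps then bounds the number N of children by
   (m+1) N <= p + m + (m+1)m(m-1)/6 for every m, whence N <= p^(5/6). *)

Set Implicit Arguments. Unset Strict Implicit. Unset Printing Implicit Defensive.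
Import Order.TTheory GRing.Theory Num.Theory.
Local Open Scope ring_scope.

(** * p-integral rationals and their residues *)

(** The localisation of the integers at [p]. Congruence of [x] and [y] modulo p^e is written
    [(x - y) / p%:R ^+ e \in pint p], and the subring instance below makes the [rpred] lemmas
    apply. *)
Definition pint (p : nat) : {pred rat} := fun x => coprime p `|denq x|.

(** Any representing fraction will do: [denq x] divides [numq x * b] and is coprime to [numq x],
    hence divides [b]. *)
Lemma pintP (p : nat) (x : rat) (a b : int) :
  coprime p `|b| -> x * b%:~R = a%:~R -> x \in pint p.
Proof.
move=> cpb eq_ab; rewrite unfold_in; apply: coprime_dvdr cpb.
have eqz : numq x * b = a * denq x.
  by apply: (@intr_inj rat); rewrite !intrM -eq_ab numqE mulrAC.
have : (denq x %| numq x * b)%Z by rewrite eqz dvdz_mull.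
by rewrite dvdzE abszM Gauss_dvdr // coprime_sym coprime_num_den.
Qed.

Lemma pint_den (p : nat) (x : rat) : x \in pint p -> coprime p `|denq x|.
Proof. by []. Qed.

Lemma pint_subring (p : nat) : subring_closed (pint p).
Proof.
split=> [|x y px py|x y px py].
- by apply: (@pintP _ _ 1 1); rewrite ?coprimen1 ?mulr1.
- apply: (@pintP _ _ (numq x * denq y - numq y * denq x) (denq x * denq y)).
    by rewrite abszM coprimeMr !pint_den.
  by rewrite intrB !intrM !numqE; ring.
- apply: (@pintP _ _ (numq x * numq y) (denq x * denq y)).
    by rewrite abszM coprimeMr !pint_den.
  by rewrite !intrM !numqE; ring.
Qed.

HB.instance Definition _ (p : nat) :=
  GRing.isSubringClosed.Build rat (pint p) (pint_subring p).

Lemma pint_nat (p n : nat) : n%:R \in pint p.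
Proof. exact: rpred_nat. Qed.

Lemma pint_inv_nat (p n : nat) : coprime p n -> (n%:R)^-1 \in pint p.
Proof.
case: n => [|n] cpn; first by rewrite invr0 rpred0.
by apply: (@pintP _ _ 1 n.+1) => //; rewrite mulVf // pnatr_eq0.
Qed.

Lemma pint_pow_div (p n e : nat) : prime p -> (logn p n <= e)%N ->
  (p%:R ^+ e / n%:R) \in pint p.
Proof.
move=> p_pr; case: n => [|n] le_e; first by rewrite invr0 mulr0 rpred0.
have [m cpm nE] := pfactor_coprime p_pr (ltn0Sn n).
have p0 : (p%:R : rat) != 0 by rewrite pnatr_eq0 -lt0n prime_gt0.
rewrite nE natrM natrX -(subnK le_e) exprD invfM mulrACA divff ?expf_neq0 //.
by rewrite mulr1 rpredM ?pint_inv_nat // -natrX pint_nat.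
Qed.

Lemma pint_divp_le (p e f : nat) (x : rat) : prime p -> (e <= f)%N ->
  x / p%:R ^+ f \in pint p -> x / p%:R ^+ e \in pint p.
Proof.
move=> p_pr le_ef px.
have p0 : (p%:R : rat) != 0 by rewrite pnatr_eq0 -lt0n prime_gt0.
have -> : x / p%:R ^+ e = x / p%:R ^+ f * p%:R ^+ (f - e).
  by rewrite -[in X in _ = X * _](subnK le_ef) exprD; field; rewrite !expf_neq0.
by rewrite rpredM // -natrX pint_nat.
Qed.

(** For prime [p], the reduction map on [pint p]; elsewhere the denominator vanishes in F_p and the
    value is 0. *)
Definition red (p : nat) (x : rat) : 'F_p := (numq x)%:~R / (denq x)%:~R.

Lemma Fp_int_eq0 (p : nat) (a : int) : prime p ->
  ((a%:~R : 'F_p) == 0) = (p %| `|a|)%N.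
Proof. by move=> p_pr; rewrite -(dvdz_pcharf (pchar_Fp p_pr)). Qed.

Lemma Fp_nat_eq0 (p n : nat) : prime p -> ((n%:R : 'F_p) == 0) = (p %| n)%N.
Proof. by move=> p_pr; rewrite (dvdn_pcharf (pchar_Fp p_pr)). Qed.

Lemma redE (p : nat) (x : rat) (a b : int) : prime p ->
  coprime p `|b| -> x * b%:~R = a%:~R -> red p x = a%:~R / b%:~R.
Proof.
move=> p_pr cpb eq_ab.
have := pintP cpb eq_ab; rewrite unfold_in => cpd.
rewrite /red; apply/eqP; rewrite eqr_div ?Fp_int_eq0 -?prime_coprime //.
rewrite -!intrM; apply/eqP; congr (_%:~R).
by apply: (@intr_inj rat); rewrite !intrM -eq_ab numqE mulrAC.
Qed.

Lemma redD (p : nat) (x y : rat) : prime p -> x \in pint p -> y \in pint p ->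
  red p (x + y) = red p x + red p y.
Proof.
move=> p_pr px py.
rewrite (@redE p _ (numq x * denq y + numq y * denq x) (denq x * denq y)) //.
- rewrite intrD !intrM addf_div // Fp_int_eq0 // -prime_coprime //; exact: pint_den.
- by rewrite abszM coprimeMr !pint_den.
- by rewrite intrD !intrM !numqE; ring.
Qed.

Lemma redM (p : nat) (x y : rat) : prime p -> x \in pint p -> y \in pint p ->
  red p (x * y) = red p x * red p y.
Proof.
move=> p_pr px py.
rewrite (@redE p _ (numq x * numq y) (denq x * denq y)) //.
- by rewrite !intrM mulf_div.
- by rewrite abszM coprimeMr !pint_den.
- by rewrite !intrM !numqE; ring.
Qed.

Lemma red_inv_nat (p n : nat) : prime p -> coprime p n ->
  red p (n%:R)^-1 = (n%:R)^-1.
Proof.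
move=> p_pr cpn; rewrite (@redE p _ 1 n) ?div1r //.
rewrite mulVf // pnatr_eq0; apply: contraTneq cpn => ->.
by rewrite prime_coprime // dvdn0.
Qed.

Lemma red1 (p : nat) : prime p -> red p 1 = 1.
Proof. by move=> p_pr; rewrite -[1 in LHS]invr1 (@red_inv_nat p 1) ?coprimen1 ?invr1. Qed.

(** Turns divisibility by one more power of [p] into an equation in F_p. *)
Lemma red_eq0 (p : nat) (x : rat) : prime p -> x \in pint p ->
  (red p x == 0) = (x / p%:R \in pint p).
Proof.
move=> p_pr px; have p0 : (p%:R : rat) != 0 by rewrite pnatr_eq0 -lt0n prime_gt0.
apply/idP/idP.
- rewrite mulf_eq0 invr_eq0 !Fp_int_eq0 //.
  have := pint_den px; rewrite prime_coprime // => /negPf ->; rewrite orbF.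
  rewrite -[X in (X %| _)%N]/(absz p) -dvdzE => /dvdzP[q eq_num].
  apply: (@pintP _ _ q (denq x)); first exact: pint_den.
  by rewrite mulrAC -numqE eq_num intrM mulfK.
- move=> pxp; rewrite -[x](divfK p0) redM // ?pint_nat //.
  rewrite [red p p%:R](@redE p _ p 1) ?coprimen1 ?mulr1 //.
  by rewrite !mulf_eq0 [X in _ || (X || _)]Fp_int_eq0 //= dvdnn orbT.
Qed.

Lemma red_congr (p : nat) (x y : rat) : prime p ->
  x \in pint p -> y \in pint p -> (x - y) / p%:R \in pint p -> red p x = red p y.
Proof.
move=> p_pr px py pxy; rewrite -[x in LHS](subrK y) redD ?rpredB //.
by move: pxy; rewrite -red_eq0 ?rpredB // => /eqP ->; rewrite add0r.
Qed.

(** * Valuations and p-integrality *)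

Lemma nuM (p : nat) (x y : rat) : x != 0 -> y != 0 ->
  nu p (x * y) = nu p x + nu p y.
Proof.
move=> x0 y0; have xy0 : x * y != 0 by rewrite mulf_neq0.
have eqn : (`|numq (x * y)| * (`|denq x| * `|denq y|) =
            `|numq x| * `|numq y| * `|denq (x * y)|)%N.
  rewrite -!abszM; congr absz.
  by apply: (@intr_inj rat); rewrite !intrM !numqE; ring.
have := congr1 (logn p) eqn.
by rewrite !lognM ?muln_gt0 ?absz_gt0 ?numq_eq0 ?denq_eq0 ?x0 ?y0 // /nu; lia.
Qed.

Lemma nu_nat (p n : nat) : nu p n%:R = (logn p n)%:Z.
Proof. by rewrite /nu -[n%:R]/((Posz n)%:~R : rat) numq_int denq_int logn1 subr0. Qed.

Lemma nu_natX (p e : nat) : prime p -> nu p (p%:R ^+ e) = e%:Z.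
Proof. by move=> p_pr; rewrite -natrX nu_nat pfactorK. Qed.

Lemma pint_nu (p : nat) (x : rat) : prime p -> x != 0 ->
  (x \in pint p) = (0 <= nu p x).
Proof.
move=> p_pr x0; rewrite unfold_in prime_coprime // /nu.
have := coprime_num_den x; have [dvd_d|ndvd_d] := boolP (p %| `|denq x|)%N.
- move=> cop; rewrite (@logn_coprime p `|numq x|); last first.
    by rewrite coprime_sym; apply: coprime_dvdr dvd_d cop.
  have : (0 < logn p `|denq x|)%N by rewrite logn_gt0 mem_primes p_pr absz_gt0 denq_eq0.
  lia.
- by move=> _; rewrite (@logn_coprime p `|denq x|) ?prime_coprime // subr0.
Qed.

(** Passes between inequalities on [nu] and congruences modulo p^e; [x != 0] excludes the
    conventional value 0 of [nu] at 0. *)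
Lemma nu_ge (p e : nat) (x : rat) : prime p -> x != 0 ->
  (e%:Z <= nu p x) = (x / p%:R ^+ e \in pint p).
Proof.
move=> p_pr x0.
have p0 : (p%:R : rat) != 0 by rewrite pnatr_eq0 -lt0n prime_gt0.
have q0 : x / p%:R ^+ e != 0 by rewrite mulf_neq0 ?invr_neq0 ?expf_neq0.
rewrite pint_nu // -[x in LHS](divfK (expf_neq0 e p0)) (nuM _ q0) ?expf_neq0 //.
by rewrite nu_natX // lerDr.
Qed.

(** * The generating polynomial of H(n, _) *)

Definition Hpoly (a : rat) (n : nat) : {poly rat} :=
  \prod_(1 <= i < n.+1) (1 + (a / i%:R) *: 'X).

(** When the product is expanded, each index set [S] contributes a multiple of X^#|S|. *)
Lemma coef_Hpoly (a : rat) (n k : nat) : (Hpoly a n)`_k = a ^+ k * H n k.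
Proof.
rewrite /Hpoly big_add1 big_mkord; under eq_bigr do rewrite addrC.
rewrite bigA_distr coef_sum /H mulr_sumr [RHS]big_mkcond /=.
apply: eq_bigr => S _; rewrite -big_mkcond /= scaler_prod prodr_const coefZ coefXn.
rewrite eq_sym big_split /= prodr_const; case: eqP => [->|_]; by rewrite ?mulr1 ?mulr0.
Qed.

Lemma HSS (n k : nat) : H n.+1 k.+1 = H n k.+1 + H n k / n.+1%:R.
Proof.
have coef1 m l : H m l = (Hpoly 1 m)`_l by rewrite coef_Hpoly expr1n mul1r.
rewrite !coef1 {1}/Hpoly big_nat_recr //= -/(Hpoly 1 n).
by rewrite mulrDr mulr1 -scalerAr coefD coefZ coefMX /= div1r mulrC.
Qed.

Lemma H_diag (n : nat) : H n n = (n`!%:R)^-1.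
Proof.
rewrite /H (big_pred1 [set: 'I_n]) => [|S].
  under eq_bigl do rewrite inE.
  by rewrite prodfV fact_prod big_add1 big_mkord natr_prod.
have := max_card [in S]; rewrite card_ord => le_Sn.
by rewrite /= eqEcard subsetT cardsT card_ord eqn_leq le_Sn.
Qed.

Lemma H_gt0 (n k : nat) : (k <= n)%N -> 0 < H n k.
Proof.
move=> le_kn; rewrite /H.
have /card_gt0P[S] : (0 < #|[set S : {set 'I_n} | #|S| == k]|)%N.
  by rewrite card_draws card_ord bin_gt0.
rewrite inE => cS; rewrite (bigD1 S) //= ltr_wpDr //.
  by apply: sumr_ge0 => A _; apply: prodr_ge0 => i _; rewrite invr_ge0.
by apply: prodr_gt0 => i _; rewrite invr_gt0 ltr0n.
Qed.

Lemma H_small (n k : nat) : (n < k)%N -> H n k = 0.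
Proof.
move=> lt_nk; rewrite /H big_pred0 // => S; apply: contraTF lt_nk => /eqP <-.
by rewrite -leqNgt; have := max_card [in S]; rewrite card_ord.
Qed.

(** * Effect of deleting base-p digits on the generating polynomial *)

Lemma big_dvdn (R : Type) (idx : R) (op : Monoid.law idx) (d n : nat) (F : nat -> R) :
  (0 < d)%N ->
  \big[op/idx]_(1 <= i < n.+1 | (d %| i)%N) F i =
  \big[op/idx]_(1 <= i < (n %/ d).+1) F (d * i)%N.
Proof.
move=> d0; elim: n => [|n IHn]; first by rewrite div0n !big_geq.
rewrite big_mkcond big_nat_recr //= -big_mkcond IHn /= divnS //.
case: ifP => [dvd|_]; last by rewrite Monoid.mulm1.
have divE : (n.+1 %/ d = (n %/ d).+1)%N by rewrite divnS // dvd.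
by rewrite add1n [RHS]big_nat_recr //= -divE mulnC divnK.
Qed.

Lemma prod_congr1 (p e : nat) (I : Type) (r : seq I) (P : pred I) (F : I -> {poly rat}) :
  (forall i, P i -> exists2 C, C \is a polyOver (pint p) & F i = 1 + p%:R ^+ e *: C) ->
  exists2 C, C \is a polyOver (pint p) & \prod_(i <- r | P i) F i = 1 + p%:R ^+ e *: C.
Proof.
move=> FP; elim/big_rec: _ => [|i A /FP[C pC ->] [D pD ->]].
  by exists 0; rewrite ?rpred0 // scaler0 addr0.
exists (C + D + p%:R ^+ e *: (C * D)); last by rewrite -!mul_polyC; ring.
by rewrite !rpredD ?polyOverZ ?rpredM // -natrX pint_nat.
Qed.

(** The factors with p^h | i become 1 + X/i for i <= K, and K! clears their denominators; the other
    factors are p-integral since v_p(i) < h. *)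
Lemma Hpoly_int (p h n K : nat) : prime p -> (n %/ p ^ h = K)%N ->
  K`!%:R *: Hpoly (p%:R ^+ h) n \is a polyOver (pint p).
Proof.
move=> p_pr nK; have p0 : (p%:R : rat) != 0 by rewrite pnatr_eq0 -lt0n prime_gt0.
rewrite /Hpoly (bigID (fun i => p ^ h %| i)%N) /= big_dvdn ?expn_gt0 ?prime_gt0 //.
rewrite nK scalerAl rpredM //.
  rewrite fact_prod natr_prod -scaler_prod big_nat.
  apply: rpred_prod => i /andP[i0 _].
  have i0' : (i%:R : rat) != 0 by rewrite pnatr_eq0 -lt0n.
  rewrite natrM natrX invfM mulrA divff ?expf_neq0 // mul1r scalerDr scalerA divff //.
  by rewrite scale1r rpredD ?polyOverX ?polyOverZ ?rpred1 ?pint_nat.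
rewrite big_nat_cond; apply: rpred_prod => i /andP[/andP[i0 _] ndvd].
rewrite rpredD ?rpred1 ?polyOverZ ?polyOverX ?pint_pow_div //.
by rewrite leqNgt; apply: contraNN ndvd => lt_h; rewrite pfactor_dvdn // ltnW.
Qed.

(* Stripping the last [j] base-[p] digits of [n] only changes the terms that use
   an index not divisible by [p ^ j]. *)
Lemma Hpoly_strip (p h j n N K : nat) : prime p ->
  (n %/ p ^ j = N)%N -> (N %/ p ^ h = K)%N ->
  exists2 C, C \is a polyOver (pint p) &
    K`!%:R *: Hpoly (p%:R ^+ (h + j)) n =
    K`!%:R *: Hpoly (p%:R ^+ h) N + p%:R ^+ h.+1 *: C.
Proof.
move=> p_pr nN NK; have p0 : (p%:R : rat) != 0 by rewrite pnatr_eq0 -lt0n prime_gt0.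
rewrite {1}/Hpoly (bigID (fun i => p ^ j %| i)%N) /= big_dvdn ?expn_gt0 ?prime_gt0 // nN.
rewrite [X in X * _](_ : _ = Hpoly (p%:R ^+ h) N); last first.
  apply: eq_bigr => i _; congr (1 + _ *: _).
  by rewrite natrM natrX exprD invfM mulrA mulfK ?expf_neq0.
rewrite big_nat_cond.
have [i|C pC ->] := @prod_congr1 p h.+1 _ (index_iota 1 n.+1)
  (fun i => (0 < i < n.+1) && ~~ (p ^ j %| i))%N
  (fun i => 1 + (p%:R ^+ (h + j) / i%:R) *: 'X).
  move=> /andP[/andP[i0 _] ndvd].
  have lt_ij : (logn p i < j)%N by rewrite ltnNge -pfactor_dvdn.
  (* As v_p(i) <= j - 1, the number p^(h+j)/i is p^(h+1) times the p-integral p^(j-1)/i. *)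
  exists ((p%:R ^+ j.-1 / i%:R) *: 'X).
    by rewrite polyOverZ ?polyOverX ?pint_pow_div // -ltnS prednK // (leq_trans _ lt_ij).
  rewrite scalerA mulrA -exprD; congr (1 + (p%:R ^+ _ / _) *: _).
  by rewrite addSnnS prednK // (leq_trans _ lt_ij).
exists (K`!%:R *: Hpoly (p%:R ^+ h) N * C).
  by rewrite rpredM // Hpoly_int.
by rewrite -!mul_polyC; ring.
Qed.

Definition scaledH (p h K k n : nat) : rat := p%:R ^+ (h * k) * K`!%:R * H n k.

Lemma scaledH_strip (p h j n N K k : nat) : prime p ->
  (n %/ p ^ j = N)%N -> (N %/ p ^ h = K)%N ->
  (scaledH p (h + j) K k n - scaledH p h K k N) / p%:R ^+ h.+1 \in pint p.
Proof.
move=> p_pr nN NK; have p0 : (p%:R : rat) != 0 by rewrite pnatr_eq0 -lt0n prime_gt0.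
have [C /polyOverP pC /(congr1 (fun A : {poly rat} => A`_k))] := Hpoly_strip p_pr nN NK.
rewrite coefD !coefZ !coef_Hpoly -!exprM !mulrA ![K`!%:R * _]mulrC => eqC.
by rewrite /scaledH eqC addrC addKr mulrC mulKf ?expf_neq0.
Qed.

Lemma scaledH_int (p h n K k : nat) : prime p -> (n %/ p ^ h = K)%N ->
  scaledH p h K k n \in pint p.
Proof.
move=> p_pr nK; have /polyOverP/(_ k) := Hpoly_int p_pr nK.
by rewrite coefZ coef_Hpoly -exprM mulrA [K`!%:R * _]mulrC.
Qed.

(** * Base-p digits *)

Lemma digits_rec_fuel (p f g m : nat) : (1 < p)%N -> (m <= f)%N -> (m <= g)%N ->
  digits_rec p f m = digits_rec p g m.
Proof.
move=> p1; elim: f g m => [|f IHf] [|g] m //=; rewrite ?leqn0.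
- by move=> /eqP ->.
- by move=> _ /eqP ->.
case: eqP => // /eqP m0 lef leg; rewrite -lt0n in m0.
have lt_dm := ltn_Pdiv p1 m0.
by rewrite (IHf g) // -ltnS (leq_trans lt_dm).
Qed.

Lemma digits0 (p : nat) : digits p 0 = [::].
Proof. by []. Qed.

Lemma digits_rcons (p m c : nat) : (1 < p)%N -> (c < p)%N -> (0 < m)%N ->
  digits p (m * p + c) = rcons (digits p m) c.
Proof.
move=> p1 ltc m0; have p0 := ltnW p1; rewrite /digits.
have n0 : (0 < m * p + c)%N by rewrite addn_gt0 muln_gt0 m0 p0.
rewrite -[in X in digits_rec _ X _](prednK n0) /= -[_ == 0%N]negbK -lt0n n0 /=.
rewrite divnMDl // divn_small // addn0 modnMDl modn_small //; congr rcons.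
apply: digits_rec_fuel => //; rewrite -ltnS prednK //.
by apply: leq_trans (leq_addr _ _); rewrite ltn_Pmulr.
Qed.

Lemma digits_small (p c : nat) : (1 < p)%N -> (0 < c < p)%N -> digits p c = [:: c].
Proof.
move=> p1 /andP[c0 ltc]; rewrite /digits -[in X in digits_rec _ X _](prednK c0) /=.
rewrite gtn_eqF // divn_small // modn_small //.
by case: c.-1.
Qed.

Lemma fromdigits_rcons (p : nat) (s : seq nat) (c : nat) :
  fromdigits p (rcons s c) = (fromdigits p s * p + c)%N.
Proof. by rewrite /fromdigits foldl_rcons. Qed.

Lemma digits_gt0 (p m : nat) : (1 < p)%N -> (0 < m)%N ->
  [/\ fromdigits p (digits p m) = m, (0 < size (digits p m))%N &
      (m < p ^ size (digits p m))%N].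
Proof.
move=> p1; elim/ltn_ind: m => m IHm m0; have p0 := ltnW p1.
have [ltm|lem] := ltnP m p.
  by rewrite digits_small ?m0 // /fromdigits /= expn1.
have q0 : (0 < m %/ p)%N by rewrite divn_gt0.
have [IH1 IH2 IH3] := IHm _ (ltn_Pdiv p1 m0) q0.
have := digits_rcons p1 (ltn_pmod m p0) q0; rewrite -divn_eq => ->.
rewrite fromdigits_rcons IH1 -divn_eq size_rcons; split=> //.
by rewrite expnS mulnC -ltn_divLR.
Qed.

Lemma fromdigits_cat_div (p : nat) (s ds : seq nat) : (0 < p)%N ->
  all (fun d => d < p)%N ds ->
  (fromdigits p (s ++ ds) %/ p ^ size ds)%N = fromdigits p s.
Proof.
move=> p0; elim/last_ind: ds => [|ds c IH]; first by rewrite cats0 expn0 divn1.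
rewrite all_rcons => /andP[ltc /IH <-].
rewrite -rcons_cat fromdigits_rcons size_rcons expnS divnMA divnMDl //.
by rewrite (divn_small ltc) addn0.
Qed.

Lemma digits_cat (p K : nat) (ds : seq nat) : (1 < p)%N -> (0 < K)%N ->
  all (fun d => d < p)%N ds ->
  digits p (fromdigits p (digits p K ++ ds)) = digits p K ++ ds.
Proof.
move=> p1 K0; have [KE _ _] := digits_gt0 p1 K0.
elim/last_ind: ds => [|ds c IH]; first by rewrite cats0 KE.
rewrite all_rcons => /andP[ltc all_ds].
rewrite -rcons_cat fromdigits_rcons digits_rcons ?IH //.
have := fromdigits_cat_div (digits p K) (ltnW p1) all_ds.
by rewrite KE; case: (fromdigits _ _) => // eqK; rewrite -eqK div0n in K0.
Qed.

Lemma digits_all (p m : nat) : (1 < p)%N -> (0 < m)%N ->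
  all (fun d => d < p)%N (digits p m).
Proof.
move=> p1; elim/ltn_ind: m => m IHm m0; have p0 := ltnW p1.
have [ltm|lem] := ltnP m p; first by rewrite digits_small ?m0 //= ltm.
have q0 : (0 < m %/ p)%N by rewrite divn_gt0.
have := digits_rcons p1 (ltn_pmod m p0) q0; rewrite -divn_eq => ->.
rewrite all_rcons ltn_pmod //=.
by apply: IHm; rewrite ?ltn_Pdiv.
Qed.

(** Each factor i <= n < p^(t+1) has v_p(i) <= t. This keeps the truncated subtraction defining [W]
    in the theorem exact. *)
Lemma logn_fact_le (p t n : nat) : prime p -> (n < p ^ t.+1)%N ->
  (logn p n`! <= n * t)%N.
Proof.
move=> p_pr; elim: n => [|n IHn] ltn; first by rewrite fact0 logn1.
rewrite factS lognM ?fact_gt0 // mulSn //; apply: leq_add (IHn (ltnW ltn)).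
rewrite -ltnS -(ltn_exp2l _ _ (prime_gt1 p_pr)); apply: leq_ltn_trans ltn.
by rewrite dvdn_leq ?pfactor_dvdnn.
Qed.

(** * Harmonic sums modulo p *)

Definition harm (p c : nat) : 'F_p := \sum_(i < c) (i.+1%:R)^-1.

(* The virtual element [x], of weight [v], stands for the successor of the last
   element below [n]; this makes a plain induction on [n] go through. *)
Lemma gap_weight (P : pred nat) (m : nat) (w : nat -> nat) :
  (forall i j, P i -> P j -> i < j -> m <= j - i + w j)%N ->
  forall n x v, (forall i, i < n -> P i -> m <= x - i + v)%N -> (n <= x.+1)%N ->
  (\sum_(i < n | P i) m <= x + v + \sum_(i < n | P i) w i)%N.
Proof.
move=> gap; elim=> [|n IHn] x v xP le_nx; first by rewrite !big_ord0.
rewrite big_mkcond [X in (_ <= _ + X)%N]big_mkcond !big_ord_recr /= -!big_mkcond /=.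
case: ifP => Pn; last first.
  by rewrite !addn0; apply: IHn (ltnW le_nx) => i /ltnW; apply: xP.
have := IHn n (w n) (fun i lt_in Pi => gap i n Pi Pn lt_in) (leqnSn n).
move=> le_n; apply: leq_trans (leq_add le_n (xP n (ltnSn n) Pn)) _.
by move: (bigop _ _ _) (w n) => B u; lia.
Qed.

(** The total charge when each distance [e + 1 <= m] occurs for at most [e] pairs, each of weight
    [m - e]. *)
Lemma sum_gap_weights (m : nat) :
  (6 * \sum_(e < m) (m - e) * e = m.+1 * m * m.-1)%N.
Proof.
have gauss n : (2 * \sum_(e < n) e = n * n.-1)%N.
  by elim: n => [|n IHn]; rewrite ?big_ord0 // big_ord_recr /= mulnDr IHn; case: n {IHn} => // n; nia.
elim: m => [|m IHm]; first by rewrite big_ord0.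
rewrite big_ord_recr /= (eq_bigr (fun e : 'I_m => (m - e) * e + e)%N); last first.
  by move=> e _; rewrite subSn ?mulSn 1?addnC // ltnW.
rewrite big_split /= !mulnDr IHm subSnn mul1n; have := gauss m.
by move: (\sum_(e < m) e)%N => s; case: m {IHm} => [|m] /=; nia.
Qed.

(** The right side is the logarithmic derivative of X(X-1)...(X-d+1) at [j]. *)
Lemma harm_sub (p d j : nat) : (d <= j)%N ->
  harm p j - harm p (j - d) = \sum_(i < d) (j%:R - i%:R)^-1.
Proof.
elim: d => [|d IHd] lt_dj; first by rewrite subn0 subrr big_ord0.
have harm_last : harm p (j - d) = harm p (j - d.+1) + (j%:R - d%:R)^-1.
  by rewrite -natrB ?(ltnW lt_dj) // -(subnSK lt_dj) {1}/harm big_ord_recr.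
by rewrite big_ord_recr /= -IHd ?(ltnW lt_dj) // harm_last; ring.
Qed.

Lemma deriv_prod_XsubC (F : fieldType) (d : nat) (f : nat -> F) (x : F) :
  (forall i, (i < d)%N -> x != f i) ->
  (\prod_(i < d) ('X - (f i)%:P))^`().[x] =
  (\prod_(i < d) ('X - (f i)%:P)).[x] * \sum_(i < d) (x - f i)^-1.
Proof.
elim: d => [|d IHd] xP; first by rewrite !big_ord0 derivC hornerC mulr0.
rewrite !big_ord_recr /= derivM derivXsubC mulr1 hornerD !hornerM hornerXsubC.
rewrite IHd => [|i lt_id]; last exact/xP/ltnW.
by have := xP d (ltnSn d); rewrite -subr_eq0 => x0; field.
Qed.

Lemma Fp_nat_inj (p i j : nat) : prime p -> (i < p)%N -> (j < p)%N ->
  (i%:R = j%:R :> 'F_p) -> i = j.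
Proof.
move=> p_pr lti ltj /(congr1 val); rewrite /= !val_Fp_nat //.
by rewrite !modn_small.
Qed.

(* Such a [j] is a root of the derivative of [X (X - 1) ... (X - (d - 1))]. *)
Lemma harm_pairs (p d : nat) (a : 'F_p) : prime p -> (0 < d)%N ->
  (#|[pred j : 'I_p | (d <= j) && (harm p j == a) && (harm p (j - d) == a)]| < d)%N.
Proof.
move=> p_pr d0; set A := [pred j | _].
have [le_pd|lt_dp] := leqP p d.
  rewrite eq_card0 // => j; rewrite !inE; apply/negbTE.
  by rewrite -!andbA negb_and -ltnNge (leq_trans (ltn_ord j) le_pd).
set q : {poly 'F_p} := \prod_(i < d) ('X - (i%:R)%:P).
have size_q : size q = d.+1.
  by rewrite size_prod_XsubC [index_enum _]unlock -enumT size_enum_ord.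
have monic_q : q \is monic by apply: monic_prod_XsubC.
(* The coefficient of X^(d-1) in the derivative is [d], which is nonzero in F_p because 0 < d <
   p. *)
have q'0 : q^`() != 0.
  apply/eqP => /(congr1 (fun r : {poly 'F_p} => r`_d.-1)); rewrite coef_deriv coef0 prednK //.
  have -> : q`_d = 1 by move/eqP: monic_q; rewrite /lead_coef size_q.
  by move/eqP; rewrite Fp_nat_eq0 // gtnNdvd.
rewrite cardE -(size_map (fun j : 'I_p => j%:R : 'F_p)).
have size_q' : (size q^`() <= d)%N.
  by rewrite -ltnS -size_q lt_size_deriv // -size_poly_gt0 size_q.
apply: leq_trans size_q'; apply: max_poly_roots => //.
- apply/allP => x /mapP[j]; rewrite mem_enum !inE => /andP[/andP[le_dj /eqP h1] /eqP h2] ->.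
  rewrite rootE deriv_prod_XsubC => [|i lt_id].
    by rewrite -harm_sub // h1 h2 subrr mulr0.
  apply: contraTneq le_dj => /(Fp_nat_inj p_pr (ltn_ord j)) ->.
    by rewrite -ltnNge.
  exact: ltn_trans lt_dp.
- rewrite map_inj_uniq ?enum_uniq // => i j /(Fp_nat_inj p_pr (ltn_ord i) (ltn_ord j)).
  exact: val_inj.
Qed.

Lemma harm_count (p m : nat) (a : 'F_p) : prime p ->
  (6 * (m.+1 * #|[pred j : 'I_p | harm p j == a]|) <=
   6 * (p + m) + m.+1 * m * m.-1)%N.
Proof.
move=> p_pr; pose P j := harm p j == a.
(* A solution at distance e + 1 <= m below [j] falls short of the gap m + 1 by m - e; [w j] adds up
   these deficits. *)
pose w j := (\sum_(e < m | (e < j) && P (j - e.+1)) (m - e))%N.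
have gap i j : P i -> P j -> (i < j -> m.+1 <= j - i + w j)%N.
  move=> Pi Pj lt_ij; have [le_m|lt_m] := leqP m (j - i.+1); first lia.
  rewrite /w (bigD1 (Ordinal lt_m)) /=; first lia.
  by rewrite (_ : (j - (j - i.+1).+1)%N = i) ?Pi ?andbT; lia.
have le_sum : (\sum_(i < p | P i) m.+1 <= p + m + \sum_(i < p | P i) w i)%N.
  (* The virtual successor is p + m: it is at distance at least m + 1 from every digit, so weight 0
     suffices. *)
  rewrite -[(p + m)%N]addn0; apply: gap_weight => //; last by rewrite leqW ?leq_addr.
  by move=> i lt_ip _; lia.
have le_w : (\sum_(i < p | P i) w i <= \sum_(e < m) (m - e) * e)%N.
  (* For fixed [e], [harm_pairs] at distance e + 1 leaves at most [e] pairs. *)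
  rewrite /w (exchange_big_dep xpredT) //=; apply: leq_sum => e _.
  rewrite sum_nat_const mulnC leq_mul2l -ltnS -[e.+1]/(e.+1)%N.
  apply/orP; right; apply: leq_trans (harm_pairs a p_pr (ltn0Sn e)).
  rewrite ltnS; apply: eq_leq; apply: eq_card => j; rewrite !inE /P.
  by rewrite -andbA andbCA.
rewrite sum_nat_const mulnC in le_sum; rewrite -sum_gap_weights -mulnDr leq_mul2l /=.
by apply: leq_trans le_sum _; rewrite leq_add2l.
Qed.

(** * The exponent 0.835 *)

(** Supplies the choice of [m] in [harm_count]: for m near p^(1/3), both p/m and m^2/6 have order
    p^(2/3). *)
Lemma cube_root_floor (n : nat) :
  exists a : nat, (a * a * a <= n < a.+1 * a.+1 * a.+1)%N.
Proof.
elim: n => [|n [a /andP[le_a lt_a]]]; first by exists 0%N.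
have [lt|le] := ltnP n.+1 (a.+1 * a.+1 * a.+1)%N.
  by exists a; rewrite lt leqW.
by exists a.+1; rewrite le /=; nia.
Qed.

Module RealBound.
From Stdlib Require Import Reals Lra.
Local Open Scope R_scope.

(** Makes comparisons with x^(5/6) polynomial in z = x^(1/6). *)
Lemma sixth_root (x : R) : 0 < x ->
  exists2 z, 0 < z & z ^ 6 = x /\ z ^ 5 = Rpower x (5 / 6).
Proof.
move=> x0; exists (Rpower x (1 / 6)); first exact: exp_pos.
rewrite -!Rpower_pow; try exact: exp_pos.
rewrite !Rpower_mult !INR_IZR_INZ /=; split; last by congr (Rpower _ _); field.
rewrite -[RHS](Rpower_1 _ x0); congr (Rpower _ _); field.
Qed.

Lemma lt_Rpower_835 (x y : R) : 1 < x -> y <= Rpower x (5 / 6) ->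
  y < Rpower x (INR 835 / INR 1000).
Proof.
move=> x1 le_y; apply: Rle_lt_trans le_y _; apply: Rpower_lt => //.
by rewrite !INR_IZR_INZ /=; lra.
Qed.

Lemma small_le_Rpower (x y : R) : 0 < x -> y ^ 6 <= x ^ 5 ->
  y <= Rpower x (5 / 6).
Proof.
move=> x0 le_xy; have [z z0 [zx <-]] := sixth_root x0.
apply: Rnot_lt_le => lt_zy; apply: (Rle_not_lt _ _ le_xy).
have -> : x ^ 5 = (z ^ 5) ^ 6 by rewrite -zx; ring.
move: (z ^ 5) (pow_lt _ 5 z0) lt_zy => t t0 lt_ty.
have lt2 : t * t < y * y by nra.
have lt3 : t * t * t < y * y * y by nra.
have -> : t ^ 6 = (t * t * t) * (t * t * t) by ring.
have -> : y ^ 6 = (y * y * y) * (y * y * y) by ring.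
by have := Rmult_lt_0_compat _ _ (Rmult_lt_0_compat _ _ t0 t0) t0; nra.
Qed.

(* With [z = x ^ (1/6)] and [a] the integer part of [z ^ 2], the hypothesis gives
   [y <= 1 + 7/6 z ^ 4], which is at most [z ^ 5] as soon as [z >= 1.49]. *)
Lemma large_le_Rpower (x y a : R) : INR 11 <= x -> 0 <= a ->
  a * a * a <= x -> x < (a + 1) * (a + 1) * (a + 1) ->
  6 * ((a + 1) * y) <= 6 * (x + a) + (a + 1) * a * (a - 1) ->
  y <= Rpower x (5 / 6).
Proof.
rewrite INR_IZR_INZ /= => x11 a0; have [|z z0 [zx <-]] := @sixth_root x; first lra.
rewrite -{x}zx in x11 *.
(* 1.49^6 < 11. This bound gives w = z^2 >= 2 and (z - 7/6) w^2 >= 1, which closes the proof. *)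
have z149 : 149 / 100 <= z.
  apply: Rnot_lt_le => lt_z.
  have := pow_incr z (149 / 100) 6 (conj (Rlt_le _ _ z0) (Rlt_le _ _ lt_z)); rewrite /=; lra.
have -> : z ^ 6 = z ^ 2 * z ^ 2 * z ^ 2 by ring.
have -> : z ^ 5 = z * (z ^ 2 * z ^ 2) by ring.
have : 2 <= z ^ 2 by nra.
move: (z ^ 2) => w w2 le_a lt_a bnd.
have le_aw : a <= w.
  apply: Rnot_lt_le => lt; have : w * w < a * a by nra.
  nra.
have lt_wa : w < a + 1.
  apply: Rnot_le_lt => le; have : (a + 1) * (a + 1) <= w * w by nra.
  nra.
(* After division by a + 1, the three terms x, a and (a+1)a(a-1)/6 are at most w^2, 1 and w^2/6. *)
have le_y : y <= 7 / 6 * (w * w) + 1.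
  apply: (Rmult_le_reg_l (a + 1)); first lra.
  have : w * (w * w) <= (a + 1) * (w * w) by nra.
  have : a * (a - 1) <= w * w by nra.
  nra.
nra.
Qed.
Lemma INR_family_bound (p N a : nat) :
  (6 * (S a * N) <= 6 * (p + a) + S a * a * Nat.pred a)%coq_nat ->
  6 * ((INR a + 1) * INR N) <= 6 * (INR p + INR a) + (INR a + 1) * INR a * (INR a - 1).
Proof.
move=> /le_INR; rewrite !(plus_INR, mult_INR).
(* For [a = 0] the truncated predecessor is not a - 1, but both sit in a product with the factor a =
   0. *)
by case: a => [|a]; rewrite [Nat.pred _]/= ?S_INR [INR 0]/=; lra.
Qed.
End RealBound.

Lemma lt_pow0835_bound (p N : nat) : prime p ->
  (forall m : nat, 6 * (m.+1 * N) <= 6 * (p + m) + m.+1 * m * m.-1)%N ->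
  lt_pow0835 N p.
Proof.
move=> p_pr bnd; have p1 := prime_gt1 p_pr.
apply: RealBound.lt_Rpower_835; first by apply: (RIneq.lt_INR 1%N); apply/ssrnat.ltP.
have [le11|lt11] := leqP 11 p; last first.
  (* Taking m = 1 gives N <= 1, 2, 3, 4 for p = 2, 3, 5, 7, enough for N^6 <= p^5. *)
  have le2 : (2 * N <= p + 1)%N by have := bnd 1%N; lia.
  have le6 : (N ^ 6 <= p ^ 5)%N.
    have : p \in [:: 2%N; 3%N; 5%N; 7%N].
      move: p p_pr lt11 {p1 le2 bnd}; do 11 (case; first by []).
      by move=> n _; rewrite ltnNge.
    rewrite !inE => /or4P[] /eqP pE; rewrite pE in le2 *.
    - have leN : (N <= 1)%N by lia.
      by case: N leN {bnd le2} => [|[|]].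
    - have leN : (N <= 2)%N by lia.
      by case: N leN {bnd le2} => [|[|[|]]].
    - have leN : (N <= 3)%N by lia.
      by case: N leN {bnd le2} => [|[|[|[|]]]].
    - have leN : (N <= 4)%N by lia.
      by case: N leN {bnd le2} => [|[|[|[|[|]]]]].
  apply: RealBound.small_le_Rpower; first by apply: (RIneq.lt_INR 0%N); exact/ssrnat.ltP/ltnW.
  rewrite -!RIneq.pow_INR; apply/RIneq.le_INR/ssrnat.leP.
  by move: le6; rewrite !expnS !expn0.
have [a /andP[/ssrnat.leP/RIneq.le_INR le_a /ssrnat.ltP/RIneq.lt_INR lt_a]] := cube_root_floor p.
rewrite !RIneq.mult_INR in le_a lt_a; rewrite RIneq.S_INR in lt_a.
apply: (@RealBound.large_le_Rpower _ _ (Raxioms.INR a)) => //.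
- exact/RIneq.le_INR/ssrnat.leP.
- exact: RIneq.pos_INR.
- exact/RealBound.INR_family_bound/ssrnat.leP/bnd.
Qed.

(** * The tree *)

Definition level (p K m : nat) : nat := size (digits p m) - size (digits p K).

(** The modulus p^(u+1) at level [u] is the precision to which the first [u] extra digits determine
    the scaled value of every extension. *)
Definition vtree (p K : nat) : pred nat := fun m =>
  prefix (digits p K) (digits p m) &&
  (scaledH p (level p K m) K K.+1 m / p%:R ^+ (level p K m).+1 \in pint p).

Lemma prefix_digits (p K m : nat) : (1 < p)%N -> (0 < K)%N ->
  prefix (digits p K) (digits p m) ->
  exists2 ds, all (fun d => d < p)%N ds & m = fromdigits p (digits p K ++ ds).
Proof.
move=> p1 K0 /prefixP[ds digE]; have [_ size_K _] := digits_gt0 p1 K0.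
have m0 : (0 < m)%N.
  by rewrite lt0n; apply/eqP => m0; rewrite m0 digits0 in digE; move: size_K; case: (digits p K) digE.
exists ds; last by rewrite -digE; have [] := digits_gt0 p1 m0.
by have := digits_all p1 m0; rewrite digE all_cat => /andP[].
Qed.

Lemma vtree_cat (p K : nat) (ds : seq nat) : (1 < p)%N -> (0 < K)%N ->
  all (fun d => d < p)%N ds ->
  vtree p K (fromdigits p (digits p K ++ ds)) =
  (scaledH p (size ds) K K.+1 (fromdigits p (digits p K ++ ds))
     / p%:R ^+ (size ds).+1 \in pint p).
Proof.
move=> p1 K0 all_ds; rewrite /vtree /level digits_cat // prefix_prefix.
by rewrite size_cat addKn.
Qed.

(** By [scaledH_strip] the two scaled values agree modulo p^(size ds1 + 1), so divisibility by p^f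
    is common to both up to that exponent. *)
Lemma scaledH_cat (p K k : nat) (ds1 ds2 : seq nat) (f : nat) : prime p -> (0 < K)%N ->
  all (fun d => d < p)%N (ds1 ++ ds2) -> (f <= (size ds1).+1)%N ->
  (scaledH p (size (ds1 ++ ds2)) K k (fromdigits p (digits p K ++ ds1 ++ ds2))
     / p%:R ^+ f \in pint p) =
  (scaledH p (size ds1) K k (fromdigits p (digits p K ++ ds1)) / p%:R ^+ f \in pint p).
Proof.
move=> p_pr K0; rewrite all_cat => /andP[all1 all2] le_f; have p1 := prime_gt1 p_pr.
have [KE _ _] := digits_gt0 p1 K0.
rewrite catA size_cat.
have n2 := fromdigits_cat_div (digits p K ++ ds1) (ltnW p1) all2.
have n1 := fromdigits_cat_div (digits p K) (ltnW p1) all1; rewrite KE in n1.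
have := pint_divp_le p_pr le_f (scaledH_strip k p_pr n2 n1).
rewrite mulrBl => pd; rewrite -[X in X \in _ = _](subrK
  (scaledH p (size ds1) K k (fromdigits p (digits p K ++ ds1)) / p%:R ^+ f)).
by rewrite rpredDl.
Qed.

Lemma parent_rcons (p K : nat) (ds : seq nat) (c : nat) : (1 < p)%N -> (0 < K)%N ->
  all (fun d => d < p)%N (rcons ds c) ->
  parent p (fromdigits p (digits p K ++ rcons ds c)) = fromdigits p (digits p K ++ ds).
Proof.
move=> p1 K0 all_ds; rewrite /parent digits_cat // -rcons_cat size_rcons /=.
by rewrite -cats1 take_size_cat.
Qed.

Lemma vtree_root (p K : nat) : prime p -> (0 < K)%N -> vtree p K K.
Proof.
move=> p_pr K0; have p1 := prime_gt1 p_pr; have [KE _ _] := digits_gt0 p1 K0.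
have := @vtree_cat p K [::] p1 K0 isT; rewrite cats0 KE => ->.
(* At the root H(K, K+1) is an empty sum, so the scaled value is 0. *)
by rewrite /scaledH H_small // mulr0 mul0r rpred0.
Qed.

Lemma vtree_ptree (p K : nat) : prime p -> (0 < K)%N -> ptree p (vtree p K) K.
Proof.
move=> p_pr K0; have p1 := prime_gt1 p_pr; have [_ sK _] := digits_gt0 p1 K0.
split=> [|b /andP[pref _]|b /[dup] Tb /andP[pref _]]; first exact: vtree_root.
  split=> //; rewrite lt0n; apply/eqP => b0; move: pref.
  by rewrite b0 digits0 prefixs0 => /eqP eK; rewrite eK in sK.
have [ds all_ds bE] := prefix_digits p1 K0 pref; rewrite {b}bE in Tb pref *.
rewrite digits_cat // size_cat -[X in (X < _)%N]addn0 ltn_add2l.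
case/lastP: ds all_ds Tb {pref} => // ds c all_dsc; rewrite vtree_cat // => Tb _.
have all_ds : all (fun d => d < p)%N ds by move: all_dsc; rewrite all_rcons => /andP[].
(* Weakened by one power of [p], the condition at a child depends only on the digits of its
   parent. *)
rewrite parent_rcons // vtree_cat // -(@scaledH_cat p K K.+1 ds [:: c]) // ?cats1 //.
by apply: pint_divp_le Tb => //; rewrite size_rcons.
Qed.

(* Adding [1] to [n] adds [H(n,K) / (n+1)], and [H(n,K)] is dominated by the single term
   using all [K] multiples of [p ^ h]; hence consecutive children differ by the residues
   of consecutive harmonic numbers. *)
Lemma vtree_children (p K b : nat) : prime p -> (0 < K)%N -> vtree p K b ->
  exists a : 'F_p, forall c, (c < p)%N ->
    vtree p K (fromdigits p (digits p b ++ [:: c])) = (harm p c == a).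
Proof.
move=> p_pr K0 Tb; have p1 := prime_gt1 p_pr; have p0 := ltnW p1.
have pR0 : (p%:R : rat) != 0 by rewrite pnatr_eq0 -lt0n.
have [KE _ _] := digits_gt0 p1 K0.
have [ds all_ds bE] : exists2 ds, all (fun d => d < p)%N ds & b = fromdigits p (digits p K ++ ds).
  by apply: prefix_digits; case/andP: Tb.
have dE : digits p b = digits p K ++ ds by rewrite bE digits_cat.
have all_dc c : (c < p)%N -> all (fun d => d < p)%N (ds ++ [:: c]).
  by move=> ltc; rewrite all_cat all_ds /= ltc.
pose n c := (b * p + c)%N; pose h := (size ds).+1.
have nE c : fromdigits p (digits p K ++ ds ++ [:: c]) = n c.
  by rewrite catA cats1 fromdigits_rcons -bE.
have size_h c : size (ds ++ [:: c]) = h by rewrite size_cat addn1.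
(* Since [b] is a node, [y c] is p-integral; the child with digit [c] is a node exactly when [y c]
   vanishes modulo [p]. *)
pose y c := scaledH p h K K.+1 (n c) / p%:R ^+ h.
have py c : (c < p)%N -> y c \in pint p.
  move=> ltc; rewrite /y -(nE c) -(size_h c) scaledH_cat ?all_dc ?size_h ?leqnn //.
  by move: Tb; rewrite bE vtree_cat.
have co_n : forall c, (c.+1 < p)%N -> coprime p (n c).+1.
  move=> c ltc; rewrite prime_coprime // -addnS dvdn_addr ?dvdn_mull //.
  by rewrite gtnNdvd.
have redy c : (c < p)%N -> red p (y c) = red p (y 0%N) + harm p c.
  elim: c => [|c IHc] ltc; first by rewrite /harm big_ord0 addr0.
  have ltc' := ltnW ltc.
  pose z := scaledH p h K K (n c).
  have nK : (n c %/ p ^ h = K)%N.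
    rewrite -nE -(size_h c) fromdigits_cat_div ?KE ?all_dc //.
  have yS : y c.+1 = y c + z * ((n c).+1%:R)^-1.
    rewrite /y /z /scaledH /n addnS HSS mulnS exprD.
    by field; rewrite expf_neq0 // andbT -natrM -natrD nat1r pnatr_eq0.
  have pz : z \in pint p by apply: scaledH_int.
  (* Stripping all [h] extra digits reduces [z] modulo [p] to K! H(K, K) = 1. *)
  have redz : red p z = 1.
    rewrite -(red1 p_pr); apply: red_congr; rewrite ?rpred1 //.
    have := @scaledH_strip p 0 h (n c) K K K p_pr nK; rewrite expn0 divn1 add0n expr1.
    rewrite [scaledH p 0 _ _ _]/scaledH mul0n expr0 mul1r H_diag divff ?pnatr_eq0 -?lt0n ?fact_gt0 //.
    by apply.
  have pi := pint_inv_nat (co_n c ltc).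
  rewrite yS (redD p_pr (py c ltc') (@rpredM _ (pint p) _ _ pz pi)) (redM p_pr pz pi).
  rewrite redz mul1r red_inv_nat ?co_n // IHc // /harm big_ord_recr /= addrA.
  congr (_ + (_)^-1); rewrite /n -addnS natrD natrM.
  by rewrite (pcharf0 (pchar_Fp p_pr)) mulr0 add0r.
exists (- red p (y 0%N)) => c ltc.
rewrite dE -catA vtree_cat ?all_dc // size_h nE exprSr invfM mulrA -red_eq0 ?py //.
by rewrite -/(y c) redy // addrC addr_eq0.
Qed.

(** * Number of children and girth *)

Lemma nchildren_card (p K b : nat) : prime p -> (0 < K)%N -> vtree p K b ->
  exists a : 'F_p, nchildren p (vtree p K) b = #|[pred j : 'I_p | harm p j == a]|.
Proof.
move=> p_pr K0 /(vtree_children p_pr K0)[a aP]; exists a.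
rewrite -sum1_card big_mkcond -(big_mkord xpredT (fun j => if harm p j == a then 1 else 0)%N).
rewrite -big_mkcond sum1_count /index_iota subn0.
by apply: eq_in_count => c; rewrite mem_iota => /andP[_ ltc]; rewrite aP.
Qed.

Lemma nchildren_two (K b : nat) : (0 < K)%N -> vtree 2%N K b ->
  (0 < nchildren 2%N (vtree 2%N K) b)%N.
Proof.
move=> K0 /(@nchildren_card 2 K b isT K0)[a ->]; apply/card_gt0P.
(* Modulo 2 the harmonic numbers at 0 and 1 are 0 and 1, so the digit [a] itself is a solution. *)
exists a; rewrite inE /harm.
by case: a => [[|[|]]] // i; rewrite /= ?big_ord0 ?big_ord1 ?invr1 -val_eqE.
Qed.

(** Yields the girth as a maximum; [classic] decides a property that ranges over all nodes of the
    tree. *)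
Lemma bounded_has_max (P : nat -> Prop) (B : nat) : P 0%N -> (forall n, P n -> n <= B)%N ->
  exists g, P g /\ forall n, P n -> (n <= g)%N.
Proof.
move=> P0; elim: B => [|B IHB] bnd; first by exists 0%N.
have [PB|nPB] := classic (P B.+1); first by exists B.+1.
apply: IHB => n Pn; have := bnd n Pn; rewrite leq_eqVlt => /orP[/eqP nB|//].
by rewrite nB in Pn.
Qed.

Lemma vtree_girth (p K : nat) : prime p -> (0 < K)%N ->
  exists g : nat, girth p (vtree p K) g /\ lt_pow0835 g p /\ (p = 2%N -> g = 1%N).
Proof.
move=> p_pr K0; have [a cardE] := nchildren_card p_pr K0 (vtree_root p_pr K0).
have [g [gP gmax]] := @bounded_has_max
  (fun g => forall b, vtree p K b -> g <= nchildren p (vtree p K) b)%N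
  (nchildren p (vtree p K) K) (fun b _ => leq0n _)
  (fun n nP => nP K (vtree_root p_pr K0)).
have bnd m : (6 * (m.+1 * g) <= 6 * (p + m) + m.+1 * m * m.-1)%N.
  apply: leq_trans (harm_count m a p_pr).
  by rewrite !leq_mul2l -cardE gP ?orbT // vtree_root.
exists g; split; [by split|split; first exact: lt_pow0835_bound].
(* With m = 1 and p = 2 the bound reads 2g <= 3, while every node has a child. *)
move=> p2; have := bnd 1%N; have : (1 <= g)%N; last by rewrite p2; lia.
by apply: gmax => b; rewrite p2; exact: nchildren_two.
Qed.

(* The valuation of H(n,k) read off the tree *)
Close Scope ring_scope.
Local Open Scope nat_scope.

Theorem theorem2p1 (p k : nat) :
  prime p -> 2 <= k ->
  exists (T : pred nat) (W : nat),
    ptree p T (k - 1) /\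
    (forall ds : seq nat, all (fun d => d < p) ds ->
       let es := digits p (k - 1) in
       let n := fromdigits p (es ++ ds) in
       let t := (size es).-1 in
       let s := (size es + size ds).-1 in
       forall r : nat, t.+1 <= r <= s ->
         let m := fromdigits p (take r.+1 (es ++ ds)) in
         (T m -> (W%:Z + r%:Z - (k * s)%:Z + 1 <= nu p (H n k))%R) /\
         (leaf p T (k - 1) m -> nu p (H n k) = (W%:Z + r%:Z - (k * s)%:Z)%R)) /\
    (exists g : nat, girth p T g /\ lt_pow0835 g p /\ (p = 2 -> g = 1)).
Proof.
move=> p_pr k2; have p1 := prime_gt1 p_pr.
case: k k2 => // K K0; rewrite ltnS in K0; rewrite subn1 [K.+1.-1]/=.
have [KE size_K lt_K] := digits_gt0 p1 K0.
have le_W : logn p K`! <= K * (size (digits p K)).-1.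
  by apply: logn_fact_le; rewrite ?prednK.
(* With s = t + e and r = t + u, undoing the scaling by p^(e(K+1)) K! leaves the constant W = K t -
   v_p(K!). *)
exists (vtree p K), (K * (size (digits p K)).-1 - logn p K`!); split.
  exact: vtree_ptree.
split; last exact: vtree_girth.
move=> ds all_ds es n t s r /andP[le_tr le_rs] m.
(* [u] counts the digits of [m] beyond those of K; [r] is the index of the last digit, hence the
   successor. *)
have [u rE] : exists u, r.+1 = size es + u.
  by exists (r.+1 - size es); move: le_tr; rewrite /t; lia.
have u0 : 0 < u by move: le_tr rE; rewrite /t; lia.
have le_u : u <= size ds by move: le_rs rE; rewrite /s; lia.
have mE : m = fromdigits p (es ++ take u ds).
  by rewrite /m rE take_cat ltnNge leq_addr /= addKn.
have all_u : all (fun d => d < p) (take u ds).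
  by move: all_ds; rewrite -{1}(cat_take_drop u ds) all_cat => /andP[].
have size_u : size (take u ds) = u by rewrite size_takel.
pose e := size ds.
have n_gt : K < n.
  have := fromdigits_cat_div es (ltnW p1) all_ds; rewrite KE => <-.
  apply: ltn_Pdiv.
    by rewrite -{1}(expn0 p) ltn_exp2l // (leq_trans u0).
  rewrite lt0n; apply/eqP => n0.
  have := fromdigits_cat_div es (ltnW p1) all_ds.
  by rewrite [fromdigits _ (es ++ _)]n0 div0n KE => K0'; rewrite -K0' in K0.
have H0 := lt0r_neq0 (H_gt0 n_gt).
have pk0 : (p%:R ^+ (e * K.+1) != 0 :> rat)%R.
  by rewrite expf_neq0 // pnatr_eq0 -lt0n ltnW.
have f0 : (K`!%:R != 0 :> rat)%R by rewrite pnatr_eq0 -lt0n fact_gt0.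
have y0 : scaledH p e K K.+1 n != 0%R by rewrite /scaledH !mulf_neq0.
have nuy : (nu p (scaledH p e K K.+1 n) =
            (e * K.+1)%:Z + (logn p K`!)%:Z + nu p (H n K.+1))%R.
  by rewrite /scaledH !nuM ?mulf_neq0 // nu_natX // nu_nat.
(* The first [v] extra digits decide whether the scaled valuation at [n] reaches [f], for [f] up to
   v + 1. *)
have nuE f v : f <= v.+1 -> v <= u -> (f%:Z <= nu p (scaledH p e K K.+1 n))%R =
    (scaledH p v K K.+1 (fromdigits p (es ++ take v ds)) / p%:R ^+ f \in pint p)%R.
  move=> le_f le_v; have size_v : size (take v ds) = v.
    by rewrite size_takel // (leq_trans le_v).
  rewrite nu_ge //.
  have := @scaledH_cat p K K.+1 (take v ds) (drop v ds) f p_pr K0.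
  by rewrite cat_take_drop size_v; apply.
have Tm : vtree p K m = (u.+1%:Z <= nu p (scaledH p e K K.+1 n))%R.
  by rewrite (nuE _ u) // mE vtree_cat // size_u.
have rel : (nu p (H n K.+1) = nu p (scaledH p e K K.+1 n) +
    (K * (size (digits p K)).-1 - logn p K`!)%N%:Z + r%:Z - (K.+1 * s)%:Z - u%:Z)%R.
  have size_es : size es = t.+1 by rewrite /t prednK.
  have rE' : r = t + u by move: rE; rewrite size_es addSn => -[].
  have sE : s = t + e by rewrite /s size_es addSn.
  rewrite nuy sE rE' -/es -/t -subzn //.
  by clearbody t e; lia.
split=> [|[_ Tpar nTm]].
  by rewrite Tm rel; lia.
(* The parent of a leaf is a node with u - 1 extra digits, so the scaled valuation is at least [u];
   as [m] is not a node, it equals [u]. *)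
have : (u%:Z <= nu p (scaledH p e K K.+1 n))%R.
  have u1 : u.-1 < size ds by rewrite prednK.
  have takeE := take_nth 0 u1; rewrite prednK // in takeE.
  have size_u1 : size (take u.-1 ds) = u.-1 by rewrite size_takel // ltnW.
  rewrite (nuE _ u.-1) ?prednK ?leq_pred //.
  move: Tpar; rewrite mE takeE parent_rcons -?takeE // vtree_cat //.
    by rewrite size_u1 prednK.
  by move: all_u; rewrite takeE all_rcons => /andP[].
move: nTm; rewrite Tm rel; lia.
Qed.
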